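(* Let $\Pi$ be a topological parallelism or a topological oriented parallelism on $\mathrm{PG}(3,\mathbb{R})$ whose automorphism group contains a copy of $\mathrm{SO}_3\mathbb{R}$ with irreducible action, that is, a subgroup conjugate in $\mathrm{PGL}(4,\mathbb{R})$ to the group induced on $\mathrm{PG}(3,\mathbb{R})$ by the action of $\mathrm{Spin}_3=\mathrm{SU}(2,\mathbb{C})$ on $\mathbb{C}^2=\mathbb{R}^4$. Then $\Pi$ is Clifford, i.e. $\Pi$ is equivalent under $\mathrm{PGL}(4,\mathbb{R})$ to the ordinary (resp. oriented) Clifford parallelism.
   Context: **Lines and spreads.** Let $\mathcal{L}$ be the space of lines of $\mathrm{PG}(3,\mathbb{R})$, i.e. the Grassmannian of $2$-dimensional subspaces of $\mathbb{R}^4$ with its usual topology. Let $\mathcal{L}^+$ be its twofold covering consisting of the oriented lines (oriented $2$-dimensional subspaces). A topological spread (resp. oriented spread) is a compact connected subset $\mathcal{C}$ of $\mathcal{L}$ (resp. $\mathcal{L}^+$) such that each point of $\mathrm{PG}(3,\mathbb{R})$ is incident with exactly one member of $\mathcal{C}$. **Parallelisms.** A topological parallelism (also called ordinary parallelism), resp. topological oriented parallelism, is a set $\Pi$ of topological spreads, resp. oriented spreads, such that every line, resp. every oriented line, belongs to exactly one of them, and such that $\Pi$ is compact in the Hausdorff topology on the hyperspace of compact subsets of $\mathcal{L}$, resp. $\mathcal{L}^+$. The automorphism group $\operatorname{Aut}\Pi$ consists of all elements of $\mathrm{PGL}(4,\mathbb{R})$ whose induced action on $\mathcal{L}$, resp.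 $\mathcal{L}^+$, maps $\Pi$ to itself. Two parallelisms are equivalent if an element of $\mathrm{PGL}(4,\mathbb{R})$ maps one to the other. **Clifford parallelism.** Identify $\mathbb{R}^4$ with the quaternions $\mathbb{H}$. Let $\Lambda$ and $\Upsilon$ be the subgroups of $\mathrm{PSO}(4,\mathbb{R})$ induced by the maps $q\mapsto aq$ and $q\mapsto qb$, respectively, where $a,b$ are quaternions of norm $1$. Both are isomorphic to $\mathrm{SO}_3\mathbb{R}$, both represent the irreducible action of $\mathrm{SO}_3\mathbb{R}$ (they are conjugate in $\mathrm{PGL}(4,\mathbb{R})$ via quaternion conjugation), and $\mathrm{PSO}(4,\mathbb{R})=\Lambda\times\Upsilon$. The left (resp. right) ordinary Clifford parallelism is the set of $\Lambda$-orbits (resp. $\Upsilon$-orbits) in $\mathcal{L}$. The left and right oriented Clifford parallelisms are the sets of $\Lambda$-orbits and of $\Upsilon$-orbits in $\mathcal{L}^+$. The left and right versions are equivalent to each other via quaternion conjugation, so one speaks of ''the'' Clifford parallelism. *)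

(* Defs.v *)
From HB Require Import structures.
From mathcomp Require Import all_boot all_order all_algebra.
From mathcomp Require Import spectral.
From mathcomp Require Import all_classical all_reals all_analysis.
From mathcomp Require Import complex.

Set Implicit Arguments.
Unset Strict Implicit.
Unset Printing Implicit Defensive.

Import Order.TTheory GRing.Theory Num.Theory.
Import numFieldNormedType.Exports.

Local Open Scope classical_set_scope.
Local Open Scope ring_scope.
Local Open Scope quotient_scope.

(* A frame is an ordered basis of a 2-dimensional subspace of R^4, written as
   the two rows of a matrix; frames carry the subspace topology. *)
Definition frame (R : realType) : Type :=
  set_type [set B : 'M[R]_(2, 4) | row_free B].

HB.instance Definition _ (R : realType) := Topological.on (frame R).
HB.instance Definition _ (R : realType) := SubChoice.on (frame R).

Section Lines.
Variables (R : realType) (o : bool).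

(* Two frames span the same line iff they differ by an invertible A, and the
   same oriented line iff moreover \det A > 0.  The boolean o selects oriented
   lines (o = true) or ordinary lines (o = false). *)
Definition change_of_basis : set 'M[R]_2 :=
  [set A | A \in unitmx /\ (o -> 0 < \det A)].

Definition same_line (B B' : frame R) : bool :=
  `[< exists2 A, change_of_basis A & val B' = A *m val B >].

Lemma same_line_refl : reflexive same_line.
Proof.
move=> B; apply/asboolP; exists 1%:M; last by rewrite mul1mx.
by split; rewrite ?unitmx1// det1.
Qed.

Lemma same_line_sym : symmetric same_line.
Proof.
suff H B B' : same_line B B' -> same_line B' B.
  by move=> B B'; apply/idP/idP; exact: H.
move=> /asboolP[A [uA oA] BB']; apply/asboolP; exists (invmx A).
  by split; rewrite ?unitmx_inv// det_inv invr_gt0.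
by rewrite BB' mulmxA mulVmx// mul1mx.
Qed.

Lemma same_line_trans : transitive same_line.
Proof.
move=> B2 B1 B3 /asboolP[A [uA oA] E2] /asboolP[A' [uA' oA'] E3].
apply/asboolP; exists (A' *m A); last by rewrite E3 E2 mulmxA.
split=> [|ot]; first by rewrite unitmx_mul uA'.
by rewrite det_mulmx mulr_gt0 ?oA ?oA'.
Qed.

Canonical same_line_equiv :=
  EquivRel same_line same_line_refl same_line_sym same_line_trans.

(* The Grassmannian of 2-dimensional subspaces of R^4 (o = false), resp. its
   twofold covering by oriented subspaces (o = true), as quotients of the space
   of frames by GL(2,R), resp. GL+(2,R). *)
Definition line : Type := quotient_topology {eq_quot same_line}.

HB.instance Definition _ := Topological.on line.
HB.instance Definition _ := Quotient.on line.

Lemma line_piP (B B' : frame R) :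
  \pi_line B = \pi_line B' <-> same_line B B'.
Proof. by split=> [/eqmodP|/eqmodP]. Qed.

(* The point of PG(3,R) spanned by v != 0 lies on L. *)
Definition incident (v : 'rV[R]_4) (L : line) : bool :=
  (v <= val (repr L))%MS.

Lemma incident_pi v (B : frame R) : incident v (\pi_line B) = (v <= val B)%MS.
Proof.
rewrite /incident; case: piP => B' /line_piP /asboolP[A [uA _] ->].
apply/idP/idP => /submx_trans; first by apply; exact: submxMl.
by apply; apply/submxP; exists (invmx A); rewrite mulmxA mulVmx// mul1mx.
Qed.

(* The collineation x |-> x *m g, for invertible g; it does not depend on the
   chosen frame (line_act_pi), and only on the class of g in PGL(4,R)
   (line_act_scale).  The value is irrelevant if g is not invertible. *)
Definition line_act (g : 'M[R]_4) (L : line) : line :=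
  \pi_line (insubd (repr L) (val (repr L) *m g)).

Lemma val_frame_act (B0 B : frame R) (g : 'M[R]_4) :
  g \in unitmx -> val (insubd B0 (val B *m g)) = val B *m g.
Proof.
move=> ug; rewrite val_insubd ifT//; apply/mem_set => /=.
have := set_valP B; rewrite /= /row_free => /eqP rB.
by rewrite mxrankMfree ?row_free_unit//; apply/eqP.
Qed.

Lemma line_act_pi (g : 'M[R]_4) (B : frame R) : g \in unitmx ->
  line_act g (\pi_line B) = \pi_line (insubd B (val B *m g)).
Proof.
move=> ug; rewrite /line_act; case: piP => B' /line_piP /asboolP[A cA E].
apply/esym/line_piP/asboolP; exists A => //.
by rewrite !val_frame_act// E mulmxA.
Qed.

Lemma line_act_scale (c : R) (g : 'M[R]_4) : c != 0 -> g \in unitmx ->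
  line_act (c *: g) = line_act g.
Proof.
move=> c0 ug; apply/funext => L; apply/esym/line_piP/asboolP.
have ucg : c *: g \in unitmx by rewrite unitmxZ ?unitfE.
exists c%:M.
  split; rewrite ?unitmxE det_scalar ?unitfE ?expf_neq0//.
  by rewrite exprn_even_gt0//= c0.
by rewrite !val_frame_act// mul_scalar_mx scalemxAr.
Qed.

Definition spread (C : set line) : Prop :=
  [/\ compact C, connected C &
      forall v : 'rV[R]_4, v != 0 -> exists! L, C L /\ incident v L].

(* The sets g(C), for C in P. *)
Definition act_family (g : 'M[R]_4) (P : set (set line)) : set (set line) :=
  [set line_act g @` C | C in P].

(* Aut P, as a set of representatives in GL(4,R). *)
Definition Aut (P : set (set line)) : set 'M[R]_4 :=
  [set g | g \in unitmx /\ act_family g P = P].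

Definition equivalent (P Q : set (set line)) : Prop :=
  exists2 g : 'M[R]_4, g \in unitmx & act_family g P = Q.

End Lines.

Section Hyperspace.
Variables (R : realType) (X : topologicalType).

Record compatible_metric := CompatibleMetric {
  cdist :> X -> X -> R ;
  cdist_eq0 : forall x y, cdist x y = 0 <-> x = y ;
  cdist_sym : forall x y, cdist x y = cdist y x ;
  cdist_triangle : forall x y z, cdist x z <= cdist x y + cdist y z ;
  cdist_nbhs : forall x (A : set X),
    nbhs x A <-> exists2 e, 0 < e & [set y | cdist x y < e] `<=` A
}.

Definition hyperspace (d : compatible_metric) : Type :=
  set_type [set K : set X | compact K /\ K !=set0].

Variable d : compatible_metric.

HB.instance Definition _ := SubChoice.on (hyperspace d).

(* For nonempty compact sets this says that their Hausdorff distance is < e. *)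
Definition hausdorff_ball (K : hyperspace d) (e : R) : set (hyperspace d) :=
  [set K' | (forall x, val K x -> exists2 y, val K' y & d x y < e) /\
            (forall y, val K' y -> exists2 x, val K x & d x y < e)].

Lemma hausdorff_ball_center K e : 0 < e -> hausdorff_ball K e K.
Proof.
move=> e0; have dxx x : d x x < e by rewrite (cdist_eq0 d x x).2.
by split=> x Kx; exists x.
Qed.

Lemma hausdorff_ball_sym K K' e :
  hausdorff_ball K e K' -> hausdorff_ball K' e K.
Proof.
move=> [h1 h2]; split=> x Kx.
  by have [y Ky dxy] := h2 _ Kx; exists y => //; rewrite cdist_sym.
by have [y Ky dxy] := h1 _ Kx; exists y => //; rewrite cdist_sym.
Qed.

Lemma hausdorff_ball_triangle K1 K2 K3 e1 e2 :
  hausdorff_ball K1 e1 K2 -> hausdorff_ball K2 e2 K3 ->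
  hausdorff_ball K1 (e1 + e2) K3.
Proof.
move=> [h1 h1'] [h2 h2']; split=> x Kx.
  have [y /h2[z Kz dyz] dxy] := h1 _ Kx; exists z => //.
  by rewrite (le_lt_trans (cdist_triangle d x y z))// ltrD.
have [y /h1'[z Kz dyz] dxy] := h2' _ Kx; exists z => //.
by rewrite (le_lt_trans (cdist_triangle d z y x))// ltrD.
Qed.

HB.instance Definition _ := hasNbhs.Build (hyperspace d)
  (nbhs_ (entourage_ hausdorff_ball)).
HB.instance Definition _ := Nbhs_isPseudoMetric.Build R (hyperspace d)
  erefl hausdorff_ball_center hausdorff_ball_sym hausdorff_ball_triangle erefl.

End Hyperspace.

(* The Hausdorff topology on the compact subsets of X does not depend on the
   metric that is used to define it. *)
Definition hausdorff_compact (R : realType) (X : topologicalType)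
    (P : set (set X)) : Prop :=
  exists d : compatible_metric R X, compact [set K : hyperspace d | P (val K)].

Definition parallelism (R : realType) (o : bool) (P : set (set (line R o))) :
    Prop :=
  [/\ forall C, P C -> spread C,
      forall L, exists! C, P C /\ C L &
      hausdorff_compact R P].

Section Clifford.
Variable R : realType.

(* Multiplication of quaternions p0 + p1 i + p2 j + p3 k. *)
Definition qmul (p q : 'rV[R]_4) : 'rV[R]_4 :=
  let p0 := p 0 (inord 0) in let p1 := p 0 (inord 1) in
  let p2 := p 0 (inord 2) in let p3 := p 0 (inord 3) in
  let q0 := q 0 (inord 0) in let q1 := q 0 (inord 1) in
  let q2 := q 0 (inord 2) in let q3 := q 0 (inord 3) in
  \row_(n < 4) nth 0
    [:: p0 * q0 - p1 * q1 - p2 * q2 - p3 * q3;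
        p0 * q1 + p1 * q0 + p2 * q3 - p3 * q2;
        p0 * q2 - p1 * q3 + p2 * q0 + p3 * q1;
        p0 * q3 + p1 * q2 - p2 * q1 + p3 * q0] n.

(* The maps q |-> a q with a of norm 1, as matrices acting from the right. *)
Definition Lambda : set 'M[R]_4 :=
  [set lin1_mx (qmul a) | a in [set a : 'rV[R]_4 | \sum_i a 0 i ^+ 2 = 1]].

(* The left Clifford parallelism. *)
Definition clifford (o : bool) : set (set (line R o)) :=
  [set [set line_act g L | g in Lambda] | L in setT].

(* The C-linear map z |-> z *m A of C^2 in the real coordinates
   (Re z, Im z) of R^4. *)
Definition realify (A : 'M[R[i]]_2) : 'M[R]_4 :=
  let X := map_mx (@complex.Re R) A in
  let Y := map_mx (@complex.Im R) A in
  block_mx X Y (- Y) X.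

Definition SU2 : set 'M[R[i]]_2 :=
  [set A | A \is unitarymx /\ \det A = 1].

Definition irreducible_SO3 : set 'M[R]_4 := realify @` SU2.

End Clifford.

Arguments Lambda : clear implicits.
Arguments clifford : clear implicits.
Arguments SU2 : clear implicits.
Arguments irreducible_SO3 : clear implicits.

(* Main.v *)
From HB Require Import structures.
Require Import Defs.
From mathcomp Require Import all_boot all_order all_algebra.
From mathcomp Require Import all_classical all_reals all_analysis.
From mathcomp Require Import spectral complex.
From mathcomp Require Import ring lra.

Set Implicit Arguments.
Unset Strict Implicit.
Unset Printing Implicit Defensive.

Import Order.TTheory GRing.Theory Num.Theory.
Import numFieldNormedType.Exports.

Local Open Scope classical_set_scope.
Local Open Scope ring_scope.
Local Open Scope quotient_scope.

(* Identify R^4 with the quaternions so that SU(2) acts by left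
   multiplications.  An oriented line spanned by u, v has the axis x = v u^-1,
   and it is mapped to itself by the left multiplications from the field R(x).
   If L belongs to the class C of the parallelism, then these maps send C to a
   class containing L, hence to C.  If two lines of C have axes that do not
   commute, the two fields generate the group of all nonzero quaternions; thus
   C is invariant under all left multiplications, and it is the orbit of any of
   its lines.  Otherwise all lines of C have the same axis up to sign, and by
   connectedness the sign is constant in the oriented case; then C is an orbit
   of the right multiplications.  As each orbit of the first kind meets each
   orbit of the second kind, only one kind occurs, and the parallelism is the
   left or the right Clifford parallelism. *)

(** * Quaternion arithmetic in real coordinates *)

Section Quaternions.
Variable R : realType.
Implicit Types (u v w x y z : 'rV[R]_4) (a b c d s t : R).

Definition quat a b c d : 'rV[R]_4 := \row_(n < 4) nth 0 [:: a; b; c; d] n.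

Definition qre u : R := u 0 (inord 0).

Definition qconj u : 'rV[R]_4 :=
  quat (u 0 (inord 0)) (- u 0 (inord 1)) (- u 0 (inord 2)) (- u 0 (inord 3)).

Definition qnorm u : R := \sum_i u 0 i ^+ 2.

Lemma quatE a b c d : ((quat a b c d 0 (inord 0) = a) *
  (quat a b c d 0 (inord 1) = b) * (quat a b c d 0 (inord 2) = c) *
  (quat a b c d 0 (inord 3) = d))%type.
Proof. by rewrite !mxE !inordK. Qed.

Lemma quatP u : exists a b c d, u = quat a b c d.
Proof.
exists (u 0 (inord 0)), (u 0 (inord 1)), (u 0 (inord 2)), (u 0 (inord 3)).
apply/rowP=> i; rewrite !mxE.
case: i => [[|[|[|[|//]]]]] Hi /=; congr (u 0 _);
  by apply/val_inj; rewrite /= inordK.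
Qed.

Lemma quat_inj a b c d a' b' c' d' : quat a b c d = quat a' b' c' d' ->
  [/\ a = a', b = b', c = c' & d = d'].
Proof.
by move=> E; split;
  [rewrite -[a](quatE a b c d) E|rewrite -[b](quatE a b c d) E
  |rewrite -[c](quatE a b c d) E|rewrite -[d](quatE a b c d) E];
  rewrite quatE.
Qed.

Lemma quat_mul a b c d a' b' c' d' :
  qmul (quat a b c d) (quat a' b' c' d') =
  quat (a * a' - b * b' - c * c' - d * d') (a * b' + b * a' + c * d' - d * c')
       (a * c' - b * d' + c * a' + d * b') (a * d' + b * c' - c * b' + d * a').
Proof. by rewrite /qmul !quatE. Qed.

Lemma quat_add a b c d a' b' c' d' :
  quat a b c d + quat a' b' c' d' = quat (a + a') (b + b') (c + c') (d + d').
Proof.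
by apply/rowP=> i; rewrite !mxE; case: i => [[|[|[|[|//]]]]].
Qed.

Lemma quat_opp a b c d : - quat a b c d = quat (- a) (- b) (- c) (- d).
Proof.
by apply/rowP=> i; rewrite !mxE; case: i => [[|[|[|[|//]]]]].
Qed.

Lemma quat_scale s a b c d :
  s *: quat a b c d = quat (s * a) (s * b) (s * c) (s * d).
Proof.
by apply/rowP=> i; rewrite !mxE; case: i => [[|[|[|[|//]]]]].
Qed.

Lemma quat_conj a b c d : qconj (quat a b c d) = quat a (- b) (- c) (- d).
Proof. by rewrite /qconj !quatE. Qed.

Lemma quat_norm a b c d :
  qnorm (quat a b c d) = a ^+ 2 + b ^+ 2 + c ^+ 2 + d ^+ 2.
Proof. by rewrite /qnorm !big_ord_recl big_ord0 !mxE /= addr0 !addrA. Qed.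

Lemma quat0 : 0 = quat 0 0 0 0.
Proof.
by apply/rowP=> i; rewrite !mxE; case: i => [[|[|[|[|//]]]]].
Qed.

Definition quat_simp :=
  (quat_mul, quat_add, quat_opp, quat_scale, quat_conj, quat_norm).

Lemma qmul1r u : qmul (quat 1 0 0 0) u = u.
Proof.
by have [a [b [c [d ->]]]] := quatP u; rewrite !quat_simp; congr quat; ring.
Qed.

Lemma qmulr1 u : qmul u (quat 1 0 0 0) = u.
Proof.
by have [a [b [c [d ->]]]] := quatP u; rewrite !quat_simp; congr quat; ring.
Qed.

Lemma qmulA u v w : qmul u (qmul v w) = qmul (qmul u v) w.
Proof.
have [a [b [c [d ->]]]] := quatP u; have [a1 [b1 [c1 [d1 ->]]]] := quatP v.
have [a2 [b2 [c2 [d2 ->]]]] := quatP w.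
by rewrite !quat_simp; congr quat; ring.
Qed.

Lemma qmulDl u v w : qmul (u + v) w = qmul u w + qmul v w.
Proof.
have [a [b [c [d ->]]]] := quatP u; have [a1 [b1 [c1 [d1 ->]]]] := quatP v.
have [a2 [b2 [c2 [d2 ->]]]] := quatP w.
by rewrite !quat_simp; congr quat; ring.
Qed.

Lemma qmulDr u v w : qmul u (v + w) = qmul u v + qmul u w.
Proof.
have [a [b [c [d ->]]]] := quatP u; have [a1 [b1 [c1 [d1 ->]]]] := quatP v.
have [a2 [b2 [c2 [d2 ->]]]] := quatP w.
by rewrite !quat_simp; congr quat; ring.
Qed.

Lemma qmulZl s u v : qmul (s *: u) v = s *: qmul u v.
Proof.
have [a [b [c [d ->]]]] := quatP u; have [a1 [b1 [c1 [d1 ->]]]] := quatP v.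
by rewrite !quat_simp; congr quat; ring.
Qed.

Lemma qmulZr s u v : qmul u (s *: v) = s *: qmul u v.
Proof.
have [a [b [c [d ->]]]] := quatP u; have [a1 [b1 [c1 [d1 ->]]]] := quatP v.
by rewrite !quat_simp; congr quat; ring.
Qed.

Lemma qconjM u v : qconj (qmul u v) = qmul (qconj v) (qconj u).
Proof.
have [a [b [c [d ->]]]] := quatP u; have [a1 [b1 [c1 [d1 ->]]]] := quatP v.
by rewrite !quat_simp; congr quat; ring.
Qed.

Lemma qconjK : involutive qconj.
Proof.
by move=> u; have [a [b [c [d ->]]]] := quatP u; rewrite !quat_simp !opprK.
Qed.

Lemma qmul_conjr u : qmul u (qconj u) = qnorm u *: (quat 1 0 0 0).
Proof.
have [a [b [c [d ->]]]] := quatP u.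
by rewrite !quat_simp; congr quat; ring.
Qed.

Lemma qmul_conjl u : qmul (qconj u) u = qnorm u *: (quat 1 0 0 0).
Proof.
have [a [b [c [d ->]]]] := quatP u.
by rewrite !quat_simp; congr quat; ring.
Qed.

Lemma qnormM u v : qnorm (qmul u v) = qnorm u * qnorm v.
Proof.
have [a [b [c [d ->]]]] := quatP u; have [a1 [b1 [c1 [d1 ->]]]] := quatP v.
by rewrite !quat_simp; ring.
Qed.

Lemma qnormZ s u : qnorm (s *: u) = s ^+ 2 * qnorm u.
Proof.
by have [a [b [c [d ->]]]] := quatP u; rewrite !quat_simp; ring.
Qed.

Lemma qnorm_conj u : qnorm (qconj u) = qnorm u.
Proof.
by have [a [b [c [d ->]]]] := quatP u; rewrite !quat_simp; ring.
Qed.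

Lemma qnorm_ge0 u : 0 <= qnorm u.
Proof. by apply: sumr_ge0 => i _; exact: sqr_ge0. Qed.

Lemma qnorm_eq0 u : (qnorm u == 0) = (u == 0).
Proof.
apply/eqP/eqP => [E|->]; last first.
  by rewrite /qnorm big1// => i _; rewrite mxE expr0n.
apply/rowP => i; rewrite mxE; apply/eqP; rewrite -sqrf_eq0.
by have /psumr_eq0P := E; move=> -> // j _; exact: sqr_ge0.
Qed.

Lemma qnorm_gt0 u : (0 < qnorm u) = (u != 0).
Proof. by rewrite lt_def qnorm_ge0 qnorm_eq0 andbT. Qed.

Lemma qmul_eq0 u v : (qmul u v == 0) = (u == 0) || (v == 0).
Proof. by rewrite -!qnorm_eq0 qnormM mulf_eq0. Qed.

Lemma qconj_eq0 u : (qconj u == 0) = (u == 0).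
Proof. by rewrite -!qnorm_eq0 qnorm_conj. Qed.

Lemma quat_neq0 a b c d : (quat a b c d != 0) =
  [|| a != 0, b != 0, c != 0 | d != 0].
Proof.
rewrite quat0; apply/idP/idP.
  apply: contraR; rewrite !negb_or !negbK.
  by move=> /and4P[/eqP-> /eqP-> /eqP-> /eqP->]; exact: eqxx.
by apply: contraL => /eqP/quat_inj[-> -> -> ->]; rewrite eqxx.
Qed.

Lemma quat_eq0 a b c d : quat a b c d = 0 ->
  [/\ a = 0, b = 0, c = 0 & d = 0].
Proof. by rewrite quat0 => /quat_inj. Qed.

End Quaternions.

(** * Conjugacy of pure quaternions of equal norm *)

Section Intertwiner.
Variable R : realType.
Implicit Types (x y : 'rV[R]_4).

(** Both squares equal -|x|^2, so x (x + y) = y^2 + x y = (x + y) y, and w = x + y works unless it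
    vanishes. If y = - x, any nonzero pure quaternion orthogonal to x anticommutes with x and can be
    taken for w. *)
Lemma qmul_intertwiner x y : qre x = 0 -> qre y = 0 -> qnorm x = qnorm y ->
  exists2 w, w != 0 & qmul x w = qmul w y.
Proof.
have [a [b [c [d ->]]]] := quatP x; have [a1 [b1 [c1 [d1 ->]]]] := quatP y.
rewrite /qre !quatE => -> ->; rewrite !quat_norm => E.
have [xy0|xy0] := eqVneq (quat 0 b c d + quat 0 b1 c1 d1) 0; last first.
  exists (quat 0 b c d + quat 0 b1 c1 d1) => //.
  by rewrite !quat_simp; congr quat; try ring; lra.
move: xy0; rewrite quat_add => /quat_eq0[_ Eb Ec Ed].
have [-> -> ->] : [/\ b1 = - b, c1 = - c & d1 = - d] by split; lra.
have [bc0|bc0] := eqVneq (quat 0 (- c) b 0) 0.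
  move: bc0 => /quat_eq0[_ c0 -> _].
  have -> : c = 0 by lra.
  exists (quat 0 1 0 0); first by rewrite quat_neq0 oner_eq0 orbT.
  by rewrite !quat_simp; congr quat; ring.
by exists (quat 0 (- c) b 0) => //; rewrite !quat_simp; congr quat; ring.
Qed.

End Intertwiner.

(** * Multiplicatively closed sets of quaternions that contain two fields *)

Section Generation.
Variables (R : realType) (P : set 'rV[R]_4).
Hypothesis PM : forall u v, P u -> P v -> P (qmul u v).

Section Complex.
Hypothesis PC : forall s t, quat s t 0 0 != 0 -> P (quat s t 0 0).
Implicit Types (a b c d m n s t : R).

Let PZ s u : s != 0 -> P u -> P (s *: u).
Proof.
move=> s0 Pu; rewrite -(qmul1r u) -qmulZl; apply: PM => //.
by rewrite quat_scale !mulr0 mulr1; apply: PC; rewrite quat_neq0 s0.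
Qed.

Let PZ_inv s u : s != 0 -> P (s *: u) -> P u.
Proof.
move=> s0 /(PZ (s := s^-1)); rewrite invr_eq0 => /(_ s0).
by rewrite scalerA mulVf// scale1r.
Qed.

(* With z = c + d i, conjugation by g in C turns 1 + z j into
   1 + z g^2 / |g|^2 j; here g = |z|^2 + z' z^*, unless this vanishes. *)
Let P_rotate c d c' d' : c ^+ 2 + d ^+ 2 = c' ^+ 2 + d' ^+ 2 ->
  P (quat 1 0 c d) -> P (quat 1 0 c' d').
Proof.
move=> E Pz; pose n := c ^+ 2 + d ^+ 2.
have conj s t : quat s t 0 0 != 0 ->
    s * c - t * d = c' * s + d' * t -> s * d + t * c = d' * s - c' * t ->
    P (quat 1 0 c' d').
  move=> st0 E1 E2; have n0 : s ^+ 2 + t ^+ 2 != 0.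
    by move: st0; rewrite -qnorm_eq0 quat_norm expr0n /= !addr0.
  apply: (PZ_inv n0).
  have -> : (s ^+ 2 + t ^+ 2) *: quat 1 0 c' d' =
      qmul (qmul (quat s t 0 0) (quat 1 0 c d)) (qconj (quat s t 0 0)).
    rewrite !quat_simp; congr quat; try ring.
    - transitivity ((s * c - t * d) * s - (s * d + t * c) * t); last by ring.
      by rewrite E1 E2; ring.
    - transitivity ((s * c - t * d) * t + (s * d + t * c) * s); last by ring.
      by rewrite E1 E2; ring.
  apply: PM; first by apply: PM => //; exact: PC.
  rewrite quat_conj oppr0; apply: PC; move: st0.
  by rewrite !quat_neq0 oppr_eq0.
have [g0|g0] := eqVneq
    (quat (n + (c' * c + d' * d)) (d' * c - c' * d) 0 0) 0; last first.
  apply: (conj _ _ g0).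
  - have : c * (c ^+ 2 + d ^+ 2) = c * (c' ^+ 2 + d' ^+ 2) by rewrite E.
    rewrite /n; lra.
  - have : d * (c ^+ 2 + d ^+ 2) = d * (c' ^+ 2 + d' ^+ 2) by rewrite E.
    rewrite /n; lra.
(* If g vanishes, then 0 = g z = n (z + z'), hence z' = - z; conjugation by i then does the job. *)
move: g0 => /quat_eq0[g1 g2 _ _].
have -> : c' = - c.
  have [n0|n0] := eqVneq n 0.
    have : c ^+ 2 = 0 /\ c' ^+ 2 = 0.
      by move: n0 E; rewrite /n => n0 E; split; nra.
    move=> [/eqP + /eqP]; rewrite !sqrf_eq0 => /eqP -> /eqP ->.
    by rewrite oppr0.
  apply: (mulfI n0).
  have : c * (n + (c' * c + d' * d)) - d * (d' * c - c' * d) = 0.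
    by rewrite g1 g2; ring.
  by rewrite /n; lra.
have -> : d' = - d.
  have [n0|n0] := eqVneq n 0.
    have : d ^+ 2 = 0 /\ d' ^+ 2 = 0.
      by move: n0 E; rewrite /n => n0 E; split; nra.
    move=> [/eqP + /eqP]; rewrite !sqrf_eq0 => /eqP -> /eqP ->.
    by rewrite oppr0.
  apply: (mulfI n0).
  have : d * (n + (c' * c + d' * d)) + c * (d' * c - c' * d) = 0.
    by rewrite g1 g2; ring.
  by rewrite /n; lra.
apply: (PZ_inv (s := 1)) => //.
have -> : 1 *: quat 1 0 (- c) (- d) =
    qmul (qmul (quat 0 1 0 0) (quat 1 0 c d)) (quat 0 (- 1) 0 0).
  by rewrite !quat_simp; congr quat; ring.
apply: PM; first apply: PM => //; apply: PC;
  by rewrite quat_neq0 ?oppr_eq0 oner_eq0 orbT.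
Qed.

Variables b c d : R.
Let n := c ^+ 2 + d ^+ 2.
Hypothesis n_gt0 : 0 < n.
Hypothesis PK : forall s t, t != 0 -> P (quat s (t * b) (t * c) (t * d)).

(** The product (s - b i) (s + b i + c j + d k) is s^2 + b^2 + (s - b i) (c + d i) j. Up to a real
    factor it is 1 + z j with |z|^2 = n / (s^2 + b^2), and as s varies this takes all values up to n
    / b^2. The choice of s below gives the prescribed |z|^2 = m, and [P_rotate] adjusts the argument
    of z. *)
Let P_near1 c' d' : b ^+ 2 * (c' ^+ 2 + d' ^+ 2) <= n -> P (quat 1 0 c' d').
Proof.
set m := c' ^+ 2 + d' ^+ 2 => bm.
have [m0|m0] := eqVneq m 0.
  have [-> ->] : c' = 0 /\ d' = 0.
    have [/eqP + /eqP +] : c' ^+ 2 = 0 /\ d' ^+ 2 = 0.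
      by move: m0; rewrite /m => m0; split; nra.
    by rewrite !sqrf_eq0 => /eqP -> /eqP ->.
  by apply: PC; rewrite quat_neq0 oner_eq0.
have m_gt0 : 0 < m by rewrite lt_def m0 /m addr_ge0// sqr_ge0.
pose s := Num.sqrt (n / m - b ^+ 2).
have s2 : s ^+ 2 = n / m - b ^+ 2.
  by rewrite sqr_sqrtr// subr_ge0 ler_pdivlMr.
have nm0 : n / m != 0 by rewrite mulf_neq0 ?invr_eq0 ?gt_eqF.
apply: (@P_rotate (m / n * (s * c + b * d)) (m / n * (s * d - b * c))).
  transitivity ((m / n) ^+ 2 * ((s ^+ 2 + b ^+ 2) * n)).
    by rewrite /n; ring.
  by rewrite s2 -/m; field; rewrite m0 gt_eqF.
apply: (PZ_inv nm0).
have -> : (n / m) *: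
      quat 1 0 (m / n * (s * c + b * d)) (m / n * (s * d - b * c)) =
    qmul (quat s (- b) 0 0) (quat s (1 * b) (1 * c) (1 * d)).
  rewrite !quat_simp; congr quat.
  - by transitivity (s ^+ 2 + b ^+ 2); [rewrite s2; ring|ring].
  - by ring.
  - by field; rewrite m0 gt_eqF.
  - by field; rewrite m0 gt_eqF.
apply: PM; last by apply: PK; exact: oner_neq0.
apply: PC; rewrite quat_neq0 oppr_eq0.
apply/negP => /negP; rewrite !negb_or !negbK => /and4P[/eqP s0 /eqP b0 _ _].
by move: s2; rewrite s0 b0 expr0n /= subr0 => /esym/eqP; rewrite (negbTE nm0).
Qed.

(** Splitting off the complex factor a0 + a1 i leaves 1 + z j with |z|^2 = (a2^2 + a3^2) / (a0^2 +
    a1^2), which is small enough for [P_near1]. *)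
Let P_near a0 a1 a2 a3 : a0 != 0 ->
  b ^+ 2 * (a2 ^+ 2 + a3 ^+ 2) <= n * (a0 ^+ 2) -> P (quat a0 a1 a2 a3).
Proof.
move=> a00 H; pose m := a0 ^+ 2 + a1 ^+ 2.
have m0 : 0 < m by rewrite /m ltr_pwDl// ?sqr_ge0// exprn_even_gt0.
have a01 : quat a0 a1 0 0 != 0 by rewrite quat_neq0 a00.
have -> : quat a0 a1 a2 a3 = qmul (quat a0 a1 0 0)
    (quat 1 0 ((a0 * a2 + a1 * a3) / m) ((a0 * a3 - a1 * a2) / m)).
  by rewrite !quat_simp; congr quat; rewrite /m; field; rewrite gt_eqF.
apply: PM; first exact: PC.
apply: P_near1.
have -> : ((a0 * a2 + a1 * a3) / m) ^+ 2 + ((a0 * a3 - a1 * a2) / m) ^+ 2 =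
    (a2 ^+ 2 + a3 ^+ 2) / m.
  by rewrite /m; field; rewrite gt_eqF.
rewrite mulrA ler_pdivrMr//; apply: (le_trans H).
by rewrite ler_wpM2l ?(ltW n_gt0)// /m lerDl sqr_ge0.
Qed.

(* The square root of a, up to scaling, is a + |a|, and the ratio of its
   imaginary part to its real part is at most half of that of a. *)
Let P_sqrt u : u != 0 -> qre u != - Num.sqrt (qnorm u) ->
  P (u + Num.sqrt (qnorm u) *: quat 1 0 0 0) -> P u.
Proof.
have [a0 [a1 [a2 [a3 ->]]]] := quatP u.
set r := Num.sqrt _; rewrite /qre quatE => u0 a0r Pu.
have r2 : r ^+ 2 = a0 ^+ 2 + a1 ^+ 2 + a2 ^+ 2 + a3 ^+ 2.
  by rewrite sqr_sqrtr ?qnorm_ge0// quat_norm.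
have ra0 : 2 * (a0 + r) != 0 by rewrite mulf_neq0// ?pnatr_eq0// addr_eq0.
apply: (PZ_inv ra0); move: (PM Pu Pu); congr P.
by rewrite !quat_simp; congr quat; nra.
Qed.

Let sqrt_qnorm_ge a0 a1 a2 a3 :
  `|a0| <= Num.sqrt (qnorm (quat a0 a1 a2 a3)).
Proof.
rewrite -sqrtr_sqr ler_sqrt ?qnorm_ge0// quat_norm.
by rewrite -!addrA lerDl !addr_ge0// sqr_ge0.
Qed.

(** Here k bounds the number of square roots to extract: u + |u| has the same imaginary part as u
    and at least twice its real part, so each root gains a factor 4 in the bound, until [P_near]
    applies. *)
Let P_pos k a0 a1 a2 a3 : 0 < a0 ->
  b ^+ 2 * (a2 ^+ 2 + a3 ^+ 2) <= 4 ^+ k * (n * a0 ^+ 2) ->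
  P (quat a0 a1 a2 a3).
Proof.
elim: k a0 a1 a2 a3 => [|k IHk] a0 a1 a2 a3 a0_gt0.
  by rewrite expr0 mul1r; apply: P_near; rewrite gt_eqF.
rewrite (exprSr 4) -[_ * 4 * _]mulrA => H.
have u0 : quat a0 a1 a2 a3 != 0 by rewrite quat_neq0 gt_eqF.
have ge := sqrt_qnorm_ge a0 a1 a2 a3.
apply: (P_sqrt u0); move: ge; set r := Num.sqrt _; rewrite gtr0_norm// => ge.
  rewrite /qre quatE gt_eqF// (lt_trans _ a0_gt0)//.
  by rewrite oppr_lt0 (lt_le_trans a0_gt0).
rewrite !quat_simp !mulr0 mulr1 !addr0; apply: IHk; first lra.
apply: (le_trans H); rewrite ler_wpM2l ?exprn_ge0//.
have -> : 4 * (n * a0 ^+ 2) = n * (2 * a0) ^+ 2 by ring.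
by rewrite ler_wpM2l ?(ltW n_gt0)// ler_sqr ?nnegrE; lra.
Qed.

Let P_re_gt0 u : 0 < qre u -> P u.
Proof.
have [a0 [a1 [a2 [a3 ->]]]] := quatP u; rewrite /qre quatE => a00.
have na0 : 0 < n * a0 ^+ 2 by rewrite mulr_gt0// exprn_gt0.
pose q := b ^+ 2 * (a2 ^+ 2 + a3 ^+ 2) / (n * a0 ^+ 2).
apply: (@P_pos (Num.bound q) _ _ _ _ a00).
rewrite -ler_pdivrMr// -/q.
have q0 : 0 <= q.
  by rewrite /q divr_ge0 ?(ltW na0)// mulr_ge0 ?addr_ge0 ?sqr_ge0.
apply: (le_trans (ltW (archi_boundP q0))).
rewrite -natrX ler_nat ltnW//.
by apply: ltn_expl.
Qed.

(** A negative real part is handled by the factor -1, and the square root of a pure quaternion has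
    positive real part. *)
Lemma generated_by_complex u : u != 0 -> P u.
Proof.
move=> u0; have [ru|ru|ru] := ltgtP 0 (qre u).
- exact: P_re_gt0.
- apply: (PZ_inv (s := - 1)); first by rewrite oppr_eq0 oner_eq0.
  by apply: P_re_gt0; rewrite scaleN1r /qre mxE oppr_gt0.
- have n0 : 0 < Num.sqrt (qnorm u) by rewrite sqrtr_gt0 qnorm_gt0.
  apply: P_sqrt => //; first by rewrite -ru eq_sym oppr_eq0 gt_eqF.
  apply: P_re_gt0; move: ru n0; set r := Num.sqrt _; rewrite /qre => ru n0.
  by rewrite mxE -ru quat_scale quatE mulr1 add0r.
Qed.

End Complex.

(** For non-real x, the elements in question form the multiplicative group of the field R(x), a copy
    of the complex numbers. *)
Definition contains_field (x : 'rV[R]_4) :=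
  forall s t, s *: quat 1 0 0 0 + t *: x != 0 -> P (s *: quat 1 0 0 0 + t *: x).

End Generation.

(** * Inner automorphisms of the quaternions *)

Section Rotation.
Variables (R : realType) (q : 'rV[R]_4).
Hypothesis q_neq0 : q != 0.
Implicit Types (u v : 'rV[R]_4) (s : R).

(** The inner automorphism u -> q u q^-1. *)
Definition qrot u := (qnorm q)^-1 *: qmul (qmul q u) (qconj q).

Let qn0 : qnorm q != 0. Proof. by rewrite qnorm_eq0. Qed.

Lemma qrot_intertwine u v : qmul u q = qmul q v -> qrot v = u.
Proof.
move=> E; rewrite /qrot -E -qmulA qmul_conjr qmulZr qmulr1 scalerA.
by rewrite mulVf// scale1r.
Qed.

Lemma qmul_qrot u : qmul (qrot u) q = qmul q u.
Proof.
rewrite /qrot qmulZl -qmulA qmul_conjl qmulZr qmulr1 scalerA.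
by rewrite mulVf// scale1r.
Qed.

Lemma qrotM u v : qrot (qmul u v) = qmul (qrot u) (qrot v).
Proof.
by apply: qrot_intertwine; rewrite -qmulA qmul_qrot !qmulA qmul_qrot.
Qed.

Lemma qrotD u v : qrot (u + v) = qrot u + qrot v.
Proof. by rewrite /qrot qmulDr qmulDl scalerDr. Qed.

Lemma qrotZ s u : qrot (s *: u) = s *: qrot u.
Proof. by rewrite /qrot qmulZr qmulZl !scalerA mulrC. Qed.

Lemma qrot1 : qrot (quat 1 0 0 0) = quat 1 0 0 0.
Proof. by apply: qrot_intertwine; rewrite qmul1r qmulr1. Qed.

Lemma qrot_neq0 u : u != 0 -> qrot u != 0.
Proof.
move=> u0; rewrite scaler_eq0 invr_eq0 (negbTE qn0)/= !qmul_eq0.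
by rewrite qconj_eq0 (negbTE q_neq0) (negbTE u0).
Qed.

Lemma qrot_surj u : exists v, qrot v = u.
Proof.
exists ((qnorm q)^-1 *: qmul (qmul (qconj q) u) q); apply: qrot_intertwine.
rewrite qmulZr !qmulA qmul_conjr qmulZl qmul1r qmulZl scalerA.
by rewrite mulVf// scale1r.
Qed.

End Rotation.

(** Some inner automorphism takes r i to the imaginary part of x, where r is its length. Pulling [P]
    back along it, x becomes x0 + r i and y becomes a + b i + c j + d k. As x and y do not commute,
    r and c + d i are nonzero, so that the first field is C and the second one is suited to
    [generated_by_complex]. *)
Lemma quaternions_generated (R : realType) (P : set 'rV[R]_4) x y :
  (forall u v, P u -> P v -> P (qmul u v)) ->
  contains_field P x -> contains_field P y -> qmul x y != qmul y x ->
  forall u, u != 0 -> P u.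
Proof.
move=> PM Px Py xy.
have [x0 [x1 [x2 [x3 Ex]]]] := quatP x.
pose r := Num.sqrt (x1 ^+ 2 + x2 ^+ 2 + x3 ^+ 2).
have r2 : r ^+ 2 = x1 ^+ 2 + x2 ^+ 2 + x3 ^+ 2.
  by rewrite sqr_sqrtr// !addr_ge0 ?sqr_ge0.
have [q q0 xq] : exists2 q, q != 0 &
    qmul (quat 0 x1 x2 x3) q = qmul q (quat 0 r 0 0).
  by apply: qmul_intertwiner; rewrite /qre ?quatE// !quat_norm expr0n/=; lra.
have Ex' : x = qrot q (quat x0 r 0 0).
  have -> : quat x0 r 0 0 = x0 *: quat 1 0 0 0 + quat 0 r 0 0.
    by rewrite !quat_simp; congr quat; ring.
  rewrite qrotD qrotZ (qrot1 q0) (qrot_intertwine q0 xq) Ex.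
  by rewrite !quat_simp; congr quat; ring.
have [y' Ey'] := qrot_surj q0 y; have [a [b [c [d E]]]] := quatP y'.
have [r0 n0] : r != 0 /\ 0 < c ^+ 2 + d ^+ 2.
  suff : (r != 0) && (c ^+ 2 + d ^+ 2 != 0).
    by move=> /andP[r0 n0]; rewrite lt_def n0 addr_ge0// sqr_ge0.
  rewrite -negb_or; apply: contra xy => rn; apply/eqP.
  rewrite Ex' -Ey' -!(qrotM q0) E; congr (qrot q _).
  case/orP: rn => /eqP n0; first by rewrite n0 !quat_simp; congr quat; ring.
  have [/eqP + /eqP] : c ^+ 2 = 0 /\ d ^+ 2 = 0 by split; nra.
  rewrite !sqrf_eq0 => /eqP -> /eqP ->.
  by rewrite !quat_simp; congr quat; ring.
pose Q := [set u | P (qrot q u)].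
have QM u v : Q u -> Q v -> Q (qmul u v).
  by rewrite /Q /= (qrotM q0); exact: PM.
have QC s t : quat s t 0 0 != 0 -> Q (quat s t 0 0).
  move=> /(qrot_neq0 q0); rewrite /Q /=.
  have -> : quat s t 0 0 = (s - t * x0 / r) *: quat 1 0 0 0 +
      (t / r) *: quat x0 r 0 0.
    by rewrite !quat_simp; congr quat; field.
  by rewrite qrotD !qrotZ (qrot1 q0) -Ex'; exact: Px.
have QK s t : t != 0 -> Q (quat s (t * b) (t * c) (t * d)).
  move=> t0.
  have : quat s (t * b) (t * c) (t * d) != 0.
    rewrite quat_neq0 !mulf_eq0 (negbTE t0)/=; apply: contraTT n0.
    rewrite !negb_or !negbK => /and4P[_ _ /eqP -> /eqP ->].
    by rewrite expr0n addr0 ltxx.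
  move=> /(qrot_neq0 q0); rewrite /Q /=.
  have -> : quat s (t * b) (t * c) (t * d) =
      (s - t * a) *: quat 1 0 0 0 + t *: y'.
    by rewrite E !quat_simp; congr quat; ring.
  by rewrite qrotD !qrotZ (qrot1 q0) Ey'; exact: Py.
move=> u u0; have [v Ev] := qrot_surj q0 u.
rewrite -Ev; apply: (@generated_by_complex _ Q QM QC b c d n0 QK).
apply: contraNneq u0 => v0.
by rewrite -Ev v0 -{1}(scale0r (0 : 'rV[R]_4)) qrotZ scale0r.
Qed.

(** * Quaternion multiplications as collineations *)

Section QuaternionMatrices.
Variable R : realType.
Implicit Types (u v w a b : 'rV[R]_4).

Lemma mul_lin1_mx m n (f : 'rV[R]_m -> 'rV[R]_n) (u : 'rV[R]_m) :
  linear f -> u *m lin1_mx f = f u.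
Proof.
move=> lf; pose g : {linear 'rV[R]_m -> 'rV[R]_n} :=
  HB.pack f (GRing.isLinear.Build R _ _ _ f lf).
exact: (mul_rV_lin1 g).
Qed.

Definition lmul_mx a : 'M[R]_4 := lin1_mx (qmul a).
Definition rmul_mx b : 'M[R]_4 := lin1_mx (fun u => qmul u b).
Definition conj_mx : 'M[R]_4 := lin1_mx (@qconj R).

Lemma mul_lmul_mx u a : u *m lmul_mx a = qmul a u.
Proof. by apply: mul_lin1_mx => s v w; rewrite qmulDr qmulZr. Qed.

Lemma mul_rmul_mx u b : u *m rmul_mx b = qmul u b.
Proof. by apply: mul_lin1_mx => s v w; rewrite qmulDl qmulZl. Qed.

Lemma mul_conj_mx u : u *m conj_mx = qconj u.
Proof.
apply: mul_lin1_mx => s v w.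
have [a [b [c [d ->]]]] := quatP v; have [a1 [b1 [c1 [d1 ->]]]] := quatP w.
by rewrite !quat_simp; congr quat; ring.
Qed.

Lemma mulmx_rV_inj n (A B : 'M[R]_(4, n)) :
  (forall u, u *m A = u *m B) -> A = B.
Proof. by move=> AB; apply/row_matrixP => i; rewrite !rowE AB. Qed.

Lemma lmul_mxZ s a : lmul_mx (s *: a) = s *: lmul_mx a.
Proof.
by apply: mulmx_rV_inj => u; rewrite -scalemxAr !mul_lmul_mx qmulZl.
Qed.

Lemma rmul_mxZ s b : rmul_mx (s *: b) = s *: rmul_mx b.
Proof.
by apply: mulmx_rV_inj => u; rewrite -scalemxAr !mul_rmul_mx qmulZr.
Qed.

(** Matrices act on rows from the right, so left multiplications compose in reversed order. *)
Lemma lmul_mxM a b : lmul_mx a *m lmul_mx b = lmul_mx (qmul b a).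
Proof. by apply: mulmx_rV_inj => u; rewrite mulmxA !mul_lmul_mx qmulA. Qed.

Lemma rmul_mxM a b : rmul_mx a *m rmul_mx b = rmul_mx (qmul a b).
Proof. by apply: mulmx_rV_inj => u; rewrite mulmxA !mul_rmul_mx qmulA. Qed.

Lemma lmul_mx1 : lmul_mx (quat 1 0 0 0) = 1%:M.
Proof. by apply: mulmx_rV_inj => u; rewrite mul_lmul_mx mulmx1 qmul1r. Qed.

Lemma rmul_mx1 : rmul_mx (quat 1 0 0 0) = 1%:M.
Proof. by apply: mulmx_rV_inj => u; rewrite mul_rmul_mx mulmx1 qmulr1. Qed.

Lemma unitmx_lmul a : a != 0 -> lmul_mx a \in unitmx.
Proof.
move=> a0; suff /mulmx1_unit[] :
  lmul_mx a *m lmul_mx ((qnorm a)^-1 *: qconj a) = 1%:M by [].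
rewrite lmul_mxM qmulZl qmul_conjl scalerA mulVf ?qnorm_eq0//.
by rewrite scale1r lmul_mx1.
Qed.

Lemma unitmx_rmul b : b != 0 -> rmul_mx b \in unitmx.
Proof.
move=> b0; suff /mulmx1_unit[] :
  rmul_mx b *m rmul_mx ((qnorm b)^-1 *: qconj b) = 1%:M by [].
rewrite rmul_mxM qmulZr qmul_conjr scalerA mulVf ?qnorm_eq0//.
by rewrite scale1r rmul_mx1.
Qed.

Lemma conj_mxK : conj_mx *m conj_mx = 1%:M.
Proof.
by apply: mulmx_rV_inj => u; rewrite mulmxA !mul_conj_mx mulmx1 qconjK.
Qed.

Lemma unitmx_conj : conj_mx \in unitmx.
Proof. by have [] := mulmx1_unit conj_mxK. Qed.

Lemma rmul_mx_conj b : rmul_mx b *m conj_mx = conj_mx *m lmul_mx (qconj b).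
Proof.
apply: mulmx_rV_inj => u.
by rewrite !mulmxA mul_rmul_mx !mul_conj_mx mul_lmul_mx qconjM.
Qed.

End QuaternionMatrices.

(** * Frames of a line and its axis *)

Definition mx2 (K : comNzRingType) (a b c d : K) : 'M[K]_2 :=
  \matrix_(i, j) nth 0 (nth [::] [:: [:: a; b]; [:: c; d]] i) j.

Lemma det_mx2 (K : comNzRingType) (a b c d : K) :
  \det (mx2 a b c d) = a * d - b * c.
Proof.
rewrite (expand_det_row _ ord0) !big_ord_recl big_ord0 /cofactor !det_mx11.
rewrite !mxE /=.
by rewrite /bump /=; ring.
Qed.

Section Frames.
Variables (R : realType) (o : bool).
Implicit Types (u v w : 'rV[R]_4) (B : frame R) (L : line R o).

Local Notation fr0 B := (row 0 (val B)).
Local Notation fr1 B := (row 1 (val B)).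

Lemma line_ind (K : line R o -> Prop) :
  (forall B, K (\pi_(line R o) B)) -> forall L, K L.
Proof. by move=> KB; elim/quotW. Qed.

Lemma line_act_comp g h L : g \in unitmx -> h \in unitmx ->
  line_act h (line_act g L) = line_act (g *m h) L.
Proof.
move=> ug uh; elim/line_ind: L => B; rewrite !line_act_pi ?unitmx_mul ?ug//.
congr (\pi_ _ _); apply: val_inj.
by rewrite !val_frame_act ?unitmx_mul ?ug// mulmxA.
Qed.

Lemma line_act1 L : line_act 1%:M L = L.
Proof.
elim/line_ind: L => B; rewrite line_act_pi ?unitmx1//.
by congr (\pi_ _ _); apply: val_inj; rewrite val_frame_act ?unitmx1// mulmx1.
Qed.

Lemma line_actK g L : g \in unitmx -> line_act (invmx g) (line_act g L) = L.
Proof.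
by move=> ug; rewrite line_act_comp ?unitmx_inv// mulmxV// line_act1.
Qed.

Lemma line_actKV g L : g \in unitmx -> line_act g (line_act (invmx g) L) = L.
Proof.
by move=> ug; rewrite line_act_comp ?unitmx_inv// mulVmx// line_act1.
Qed.

Lemma incident_act g w L : g \in unitmx ->
  incident (w *m g) (line_act g L) = incident w L.
Proof.
move=> ug; elim/line_ind: L => B; rewrite line_act_pi// !incident_pi.
by rewrite val_frame_act// submxMfree// row_free_unit.
Qed.

Lemma rows2P (M N : 'M[R]_(2, 4)) :
  row 0 M = row 0 N -> row 1 M = row 1 N -> M = N.
Proof.
move=> E0 E1; apply/row_matrixP => -[[|[|//]] Hi].
  by rewrite (_ : Ordinal Hi = 0)//; exact/val_inj.
by rewrite (_ : Ordinal Hi = 1)//; exact/val_inj.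
Qed.

Lemma row0_mul_mx2 a b c d (M : 'M[R]_(2, 4)) :
  row 0 (mx2 a b c d *m M) = a *: row 0 M + b *: row 1 M.
Proof.
apply/rowP => j; rewrite !mxE !big_ord_recl big_ord0 !mxE /= addr0.
by congr (_ * _ + _ * M _ _); exact/val_inj.
Qed.

Lemma row1_mul_mx2 a b c d (M : 'M[R]_(2, 4)) :
  row 1 (mx2 a b c d *m M) = c *: row 0 M + d *: row 1 M.
Proof.
apply/rowP => j; rewrite !mxE !big_ord_recl big_ord0 !mxE /= addr0.
by congr (_ * _ + _ * M _ _); exact/val_inj.
Qed.

Lemma line_eq B B' a b c d :
  a * d - b * c != 0 -> (o -> 0 < a * d - b * c) ->
  fr0 B' = a *: fr0 B + b *: fr1 B -> fr1 B' = c *: fr0 B + d *: fr1 B ->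
  \pi_(line R o) B = \pi_(line R o) B'.
Proof.
move=> D oD E0 E1; apply/line_piP/asboolP; exists (mx2 a b c d).
  by split; rewrite ?unitmxE det_mx2// unitfE.
by apply: rows2P; rewrite ?row0_mul_mx2 ?row1_mul_mx2.
Qed.

Lemma exists_frame (A : 'M[R]_2) B : A \in unitmx ->
  exists B', val B' = A *m val B.
Proof.
move=> uA; exists (insubd B (A *m val B)); rewrite val_insubd ifT//.
apply/mem_set; rewrite /= /row_free mxrankMfree ?mxrank_unit//.
exact: set_valP B.
Qed.

Lemma frame_free B s t : s *: fr0 B + t *: fr1 B = 0 -> s = 0 /\ t = 0.
Proof.
move=> E; have rB : row_free (val B) := set_valP B.
have : row 0 (mx2 s t 0 0) *m val B = 0 by rewrite -row_mul row0_mul_mx2.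
move/eqP; rewrite mulmx_free_eq0// => /eqP/rowP H.
by split; [have := H 0|have := H 1]; rewrite !mxE.
Qed.

Lemma frame_row0_neq0 B : fr0 B != 0.
Proof.
apply/negP => /eqP E; have [] := @frame_free B 1 0.
  by rewrite E scaler0 scale0r addr0.
by move=> /eqP; rewrite oner_eq0.
Qed.

Lemma incident_row0 B : incident (fr0 B) (\pi_(line R o) B).
Proof. by rewrite incident_pi row_sub. Qed.

(** If w = s u + t v in a frame (u, v), then w and - t u + s v form a frame with transition
    determinant s^2 + t^2 > 0, so that the orientation is kept as well. *)
Lemma incident_frame w L : w != 0 -> incident w L ->
  exists2 B, L = \pi_(line R o) B & fr0 B = w.
Proof.
elim/line_ind: L => B w0; rewrite incident_pi => /submxP[D wD].
pose s := D 0 0; pose t := D 0 1.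
have wE : w = s *: fr0 B + t *: fr1 B.
  rewrite wD; apply/rowP => j; rewrite !mxE !big_ord_recl big_ord0 addr0.
  by congr (D _ _ * _ + D _ _ * val B _ _); exact/val_inj.
have st : 0 < s * s - t * - t.
  have -> : s * s - t * - t = s ^+ 2 + t ^+ 2 by ring.
  rewrite lt_def addr_ge0 ?sqr_ge0// andbT; apply: contraNneq w0 => st.
  have [/eqP + /eqP] : s ^+ 2 = 0 /\ t ^+ 2 = 0 by split; nra.
  by rewrite !sqrf_eq0 wE => /eqP-> /eqP->; rewrite !scale0r addr0.
have uA : mx2 s t (- t) s \in unitmx by rewrite unitmxE unitfE det_mx2 gt_eqF.
have [B' EB'] := exists_frame B uA; exists B'.
  by apply: (line_eq _ _ _ _ (a := s) (b := t) (c := - t) (d := s)) => //;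
    rewrite ?gt_eqF// EB' ?row0_mul_mx2 ?row1_mul_mx2.
by rewrite EB' row0_mul_mx2.
Qed.

(* The line spanned by the rows u, v of B is {(s + t x) u}, where x is the
   axis v u^-1, up to the positive factor |u|^2. *)
Definition axis B := qmul (fr1 B) (qconj (fr0 B)).

Definition qim u := quat 0 (u 0 (inord 1)) (u 0 (inord 2)) (u 0 (inord 3)).

Lemma qre_im u : u = qre u *: quat 1 0 0 0 + qim u.
Proof.
have [a [b [c [d ->]]]] := quatP u.
by rewrite /qim /qre !quatE !quat_simp; congr quat; ring.
Qed.

Lemma axis_row0 B : qmul (axis B) (fr0 B) = qnorm (fr0 B) *: fr1 B.
Proof. by rewrite /axis -qmulA qmul_conjl qmulZr qmulr1. Qed.

(** This is the quadratic equation x^2 = 2 Re(x) x - |x|^2 of the axis x, applied to the first row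
    u, since x u = |u|^2 v and |x|^2 = |u|^2 |v|^2. *)
Lemma axis_row1 B : qmul (axis B) (fr1 B) =
  (2 * qre (axis B)) *: fr1 B - qnorm (fr1 B) *: fr0 B.
Proof.
rewrite /axis; move: (fr0 B) (fr1 B) => u v.
have [a [b [c [d ->]]]] := quatP u; have [a1 [b1 [c1 [d1 ->]]]] := quatP v.
by rewrite /qre !quat_simp !quatE; congr quat; ring.
Qed.

Lemma qim_axis_neq0 B : qim (axis B) != 0.
Proof.
apply/negP => /eqP E; have := axis_row0 B.
rewrite [axis B]qre_im E addr0 qmulZl qmul1r => /eqP.
rewrite -subr_eq0 -scaleNr => /eqP/frame_free[_ /eqP].
by rewrite oppr_eq0 qnorm_eq0 (negbTE (frame_row0_neq0 B)).
Qed.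

Lemma fr0_act g B : g \in unitmx ->
  fr0 (insubd B (val B *m g)) = fr0 B *m g.
Proof. by move=> ug; rewrite val_frame_act// row_mul. Qed.

Lemma fr1_act g B : g \in unitmx ->
  fr1 (insubd B (val B *m g)) = fr1 B *m g.
Proof. by move=> ug; rewrite val_frame_act// row_mul. Qed.

(** By [axis_row0] and [axis_row1], s + t x maps the span of the frame to itself; the determinant of
    this map is |s + t x|^2 > 0, hence it preserves the orientation, too. *)
Lemma axis_stabilizes B s t : s *: quat 1 0 0 0 + t *: axis B != 0 ->
  line_act (lmul_mx (s *: quat 1 0 0 0 + t *: axis B)) (\pi_(line R o) B) =
  \pi_(line R o) B.
Proof.
move=> st0; have u := unitmx_lmul st0.
have D : s * (s + t * (2 * qre (axis B))) -
    t * qnorm (fr0 B) * (- t * qnorm (fr1 B)) =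
    qnorm (s *: quat 1 0 0 0 + t *: axis B).
  have : qnorm (axis B) = qnorm (fr0 B) * qnorm (fr1 B).
    by rewrite /axis qnormM qnorm_conj mulrC.
  have [a [b [c [d ->]]]] := quatP (axis B).
  rewrite /qre !quat_simp !quatE => E.
  transitivity (s ^+ 2 + 2 * s * t * a +
    t ^+ 2 * (qnorm (fr0 B) * qnorm (fr1 B))); first by ring.
  by rewrite -E; ring.
rewrite line_act_pi//; apply/esym.
apply: (@line_eq _ _ s (t * qnorm (fr0 B)) (- t * qnorm (fr1 B))
  (s + t * (2 * qre (axis B)))).
- by rewrite D qnorm_eq0.
- by rewrite D qnorm_gt0.
- rewrite fr0_act// mul_lmul_mx qmulDl !qmulZl axis_row0 qmul1r.
  by rewrite scalerA.
- rewrite fr1_act// mul_lmul_mx qmulDl !qmulZl axis_row1 qmul1r.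
  rewrite scalerBr !scalerA [RHS]addrC scalerDl mulNr scaleNr.
  by rewrite addrA.
Qed.

End Frames.

(** * Direction of the axis and orientation of the line *)

Section Orientation.
Variables (R : realType).
Implicit Types (u v w x y : 'rV[R]_4) (B : frame R).

Local Notation fr0 B := (row 0 (val B)).
Local Notation fr1 B := (row 1 (val B)).

Definition im_dot x y : R :=
  x 0 (inord 1) * y 0 (inord 1) + x 0 (inord 2) * y 0 (inord 2) +
  x 0 (inord 3) * y 0 (inord 3).

Lemma im_dotZ s x y z : qim x = s *: qim y -> im_dot x z = s * im_dot y z.
Proof.
rewrite /qim quat_scale => /quat_inj[_ E1 E2 E3].
by rewrite /im_dot E1 E2 E3; ring.
Qed.

Lemma im_dot_gt0 x : qim x != 0 -> 0 < im_dot x x.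
Proof.
rewrite -qnorm_gt0 /qim quat_norm /im_dot !expr2.
by rewrite mul0r add0r.
Qed.

(** The commutator is twice the cross product of the imaginary parts, so these are parallel; the
    factor comes from orthogonal projection to the imaginary part of x. *)
Lemma commuting_im x y : qim x != 0 -> qmul x y = qmul y x ->
  exists s, qim y = s *: qim x.
Proof.
move=> x0 xy; exists (im_dot x y / im_dot x x).
have := im_dot_gt0 x0; move: xy {x0}.
have [a [b [c [d ->]]]] := quatP x; have [a1 [b1 [c1 [d1 ->]]]] := quatP y.
rewrite !quat_mul => /quat_inj[_ E1 E2 E3].
rewrite /im_dot /qim !quatE quat_scale => n0.
have n1 : b * b + c * c + d * d != 0 by rewrite gt_eqF.
have F1 : c * d1 = d * c1 by lra.
have F2 : b * d1 = d * b1 by lra.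
have F3 : b * c1 = c * b1 by lra.
rewrite mulr0; congr quat; apply: (mulIf n1);
  rewrite mulrAC divfK//.
- transitivity (b * (b * b1) + c * (c * b1) + d * (d * b1)); first by ring.
  by rewrite -F2 -F3; ring.
- transitivity (b * (b * c1) + c * (c * c1) + d * (d * c1)); first by ring.
  by rewrite -F1 F3; ring.
- transitivity (b * (b * d1) + c * (c * d1) + d * (d * d1)); first by ring.
  by rewrite F1 F2; ring.
Qed.

(** The imaginary part of v conj(u) is bilinear and alternating in u and v. Hence a line determines
    the direction of its axis up to sign, and an oriented line determines the sign also. *)
Lemma qim_axis_mul (M : 'M[R]_2) B B' : val B' = M *m val B ->
  qim (axis B') = \det M *: qim (axis B).
Proof.
have -> : M = mx2 (M 0 0) (M 0 1) (M 1 0) (M 1 1).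
  apply/matrixP => -[[|[|//]] Hi] [[|[|//]] Hj]; rewrite !mxE /=;
  by congr (M _ _); exact/val_inj.
move=> E; rewrite /axis E row0_mul_mx2 row1_mul_mx2 det_mx2.
move: (M 0 0) (M 0 1) (M 1 0) (M 1 1) (fr0 B) (fr1 B) => s t s' t' u v.
have [a [b [c [d ->]]]] := quatP u; have [a1 [b1 [c1 [d1 ->]]]] := quatP v.
by rewrite /qim !quat_simp !quatE; congr quat; ring.
Qed.

Lemma frame_entry_continuous i j : continuous (fun B : frame R => val B i j).
Proof.
move=> B; apply: (@continuous_comp (frame R) 'M[R]_(2, 4) R
  (fun B : frame R => val B) (fun M : 'M[R]_(2, 4) => M i j) B).
  exact: (@initial_continuous (frame R) 'M[R]_(2, 4) val).
exact: coord_continuous.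
Qed.

Lemma im_dot_axis_continuous x :
  continuous (fun B : frame R => im_dot (axis B) x).
Proof.
have cD (f g : frame R -> R) : continuous f -> continuous g ->
    continuous (fun B => f B + g B).
  by move=> cf cg B; apply: continuousD; [exact: cf|exact: cg].
have cM (f g : frame R -> R) : continuous f -> continuous g ->
    continuous (fun B => f B * g B).
  by move=> cf cg B; apply: continuousM; [exact: cf|exact: cg].
have cN (f : frame R -> R) : continuous f -> continuous (fun B => - f B).
  by move=> cf B; apply: continuousN; exact: cf.
have cC (c : R) : continuous (fun _ : frame R => c).
  exact: cst_continuous.
have ce i j := @frame_entry_continuous i j.
(* Written out as a polynomial in the entries of the frame, the function is continuous by recursion
   on its syntax. *)
rewrite [X in continuous X](_ : _ = (fun B : frame R =>
   let e i j := val B i (inord j) in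
   (e 1 0%N * - e 0 1%N + e 1 1%N * e 0 0%N + e 1 2%N * - e 0 3%N -
     e 1 3%N * - e 0 2%N) * x 0 (inord 1) +
   (e 1 0%N * - e 0 2%N - e 1 1%N * - e 0 3%N + e 1 2%N * e 0 0%N +
     e 1 3%N * - e 0 1%N) * x 0 (inord 2) +
   (e 1 0%N * - e 0 3%N + e 1 1%N * - e 0 2%N - e 1 2%N * - e 0 1%N +
     e 1 3%N * e 0 0%N) * x 0 (inord 3))) /=; last first.
  by apply/funext => B; rewrite /im_dot /axis /qconj /qmul !mxE !inordK//=.
repeat first [progress cbv beta | lazymatch goal with
| |- continuous (fun B => _ + _) => refine (cD _ _ _ _)
| |- continuous (fun B => _ * _) => refine (cM _ _ _ _)
| |- continuous (fun B => - _) => refine (cN _ _)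
| |- continuous (fun B => ?c) => exact: cC
end | exact: ce].
Qed.

End Orientation.

(** * Orbits of left and right multiplications on lines *)

Section Orbits.
Variables (R : realType) (o : bool).
Implicit Types (u v w a b : 'rV[R]_4) (B : frame R) (L : line R o).

Local Notation fr0 B := (row 0 (val B)).
Local Notation fr1 B := (row 1 (val B)).

Definition Upsilon : set 'M[R]_4 :=
  [set rmul_mx b | b in [set b : 'rV[R]_4 | \sum_i b 0 i ^+ 2 = 1]].

Lemma qnorm1_neq0 a : qnorm a = 1 -> a != 0.
Proof. by rewrite -qnorm_eq0 => ->; exact: oner_neq0. Qed.

Lemma qnormalize a : a != 0 -> exists2 s : R, s != 0 & qnorm (s *: a) = 1.
Proof.
rewrite -qnorm_gt0 => a0; exists (Num.sqrt (qnorm a))^-1.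
  by rewrite invr_eq0 gt_eqF// sqrtr_gt0.
by rewrite qnormZ exprVn sqr_sqrtr ?(ltW a0)// mulVf// gt_eqF.
Qed.

(** Real scalars fix every line, so a can be normalized. *)
Lemma Lambda_orbit a L : a != 0 ->
  [set line_act g L | g in Lambda R] (line_act (lmul_mx a) L).
Proof.
move=> a0; have [s s0 sa] := qnormalize a0.
exists (lmul_mx (s *: a)); first by exists (s *: a).
by rewrite lmul_mxZ line_act_scale ?unitmx_lmul.
Qed.

Lemma Upsilon_orbit b L : b != 0 ->
  [set line_act g L | g in Upsilon] (line_act (rmul_mx b) L).
Proof.
move=> b0; have [s s0 sb] := qnormalize b0.
exists (rmul_mx (s *: b)); first by exists (s *: b).
by rewrite rmul_mxZ line_act_scale ?unitmx_rmul.
Qed.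

Lemma incidentZ s w L : incident w L -> incident (s *: w) L.
Proof. by rewrite /incident; exact: scalemx_sub. Qed.

Lemma incident_lmul a B :
  a != 0 -> incident (qmul a (fr0 B)) (line_act (lmul_mx a) (\pi_(line R o) B)).
Proof.
by move=> a0; rewrite -mul_lmul_mx incident_act ?unitmx_lmul ?incident_row0.
Qed.

(** Parallel axes x and x' generate the same field, so the lines are R(x) u and R(x) u', and right
    multiplication by u^-1 u' takes one to the other. The multiplier used is |u|^2 times this, and s
    > 0 makes the orientations agree. *)
Lemma rmul_line B B' s : s != 0 -> (o -> 0 < s) ->
  qim (axis B') = s *: qim (axis B) ->
  line_act (rmul_mx (qmul (qconj (fr0 B)) (fr0 B'))) (\pi_(line R o) B) =
  \pi_(line R o) B'.
Proof.
move=> s0 os E.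
have n0 : 0 < qnorm (fr0 B) by rewrite qnorm_gt0 frame_row0_neq0.
have n0' : 0 < qnorm (fr0 B') by rewrite qnorm_gt0 frame_row0_neq0.
set b := qmul _ _; have b0 : b != 0.
  by rewrite qmul_eq0 qconj_eq0 !(negbTE (frame_row0_neq0 _)).
rewrite line_act_pi ?unitmx_rmul//.
have [n n'] : qnorm (fr0 B) != 0 /\ qnorm (fr0 B') != 0 by rewrite !gt_eqF.
have E0 : qmul (fr0 B) b = qnorm (fr0 B) *: fr0 B'.
  by rewrite /b qmulA qmul_conjr qmulZl qmul1r.
have E1 : qmul (fr1 B) b = qmul (axis B) (fr0 B') by rewrite /b qmulA.
have axisE : axis B' = (qre (axis B') - s * qre (axis B)) *: quat 1 0 0 0 +
    s *: axis B.
  rewrite [LHS]qre_im E; have -> : s *: axis B =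
      (s * qre (axis B)) *: quat 1 0 0 0 + s *: qim (axis B).
    by rewrite {1}[axis B]qre_im scalerDr scalerA.
  by rewrite addrA -scalerDl subrK.
(* The image frame has the rows u b = |u|^2 u' and v b = x u', while v' = q (r + s x) u'; the change
   of basis can be read off from this. *)
pose p := (qnorm (fr0 B))^-1; pose q := (qnorm (fr0 B'))^-1.
pose r := qre (axis B') - s * qre (axis B).
have D : p * (q * s) - 0 * (q * r * p) = p * q * s by ring.
apply: (@line_eq _ _ _ _ p 0 (q * r * p) (q * s)).
- by rewrite D !mulf_neq0 ?invr_eq0.
- by move=> /os s_gt0; rewrite D !mulr_gt0 ?invr_gt0.
- rewrite fr0_act ?fr1_act ?unitmx_rmul// !mul_rmul_mx E0 scale0r addr0.
  by rewrite scalerA mulVf// scale1r.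
- rewrite fr0_act ?fr1_act ?unitmx_rmul// !mul_rmul_mx E0 E1.
  rewrite scalerA -[_ * p * _]mulrA mulVf// mulr1 -!scalerA -scalerDr.
  have -> : r *: fr0 B' + s *: qmul (axis B) (fr0 B') = qmul (axis B') (fr0 B').
    by rewrite [axis B' in RHS]axisE qmulDl !qmulZl qmul1r.
  by rewrite axis_row0 scalerA mulVf// scale1r.
Qed.

Lemma qim_add s t w :
  qim (s *: quat 1 0 0 0 + t *: qim w) = t *: qim w.
Proof.
have [a [b [c [d ->]]]] := quatP w.
by rewrite /qim !quatE !quat_simp !quatE; congr quat; ring.
Qed.

(** Left multiplication by a turns the axis x into a x conj(a). An intertwiner of the two imaginary
    parts, rescaled to equal norm, makes the new axis a positive multiple of the axis of [B'] up to
    real parts, and [rmul_line] applies. *)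
Lemma Lambda_meets_Upsilon B B' : exists a b, [/\ a != 0, b != 0 &
  line_act (lmul_mx a) (\pi_(line R o) B) =
  line_act (rmul_mx b) (\pi_(line R o) B')].
Proof.
pose x := qim (axis B); pose y := qim (axis B').
have x0 : 0 < Num.sqrt (qnorm x) by rewrite sqrtr_gt0 qnorm_gt0 qim_axis_neq0.
have y0 : 0 < Num.sqrt (qnorm y) by rewrite sqrtr_gt0 qnorm_gt0 qim_axis_neq0.
have [||| a a0 aE] := @qmul_intertwiner R (Num.sqrt (qnorm x) *: y)
    (Num.sqrt (qnorm y) *: x).
- by rewrite /qre mxE /y /qim quatE mulr0.
- by rewrite /qre mxE /x /qim quatE mulr0.
- by rewrite !qnormZ !sqr_sqrtr ?qnorm_ge0// mulrC.
have u := unitmx_lmul a0.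
pose B1 := insubd B (val B *m lmul_mx a).
have n0 : 0 < qnorm a by rewrite qnorm_gt0.
pose s := qnorm a * Num.sqrt (qnorm x) / Num.sqrt (qnorm y).
have s0 : 0 < s by rewrite /s divr_gt0// mulr_gt0.
have axis1 : axis B1 = qmul (qmul a (axis B)) (qconj a).
  rewrite /axis fr0_act// fr1_act// !mul_lmul_mx qconjM.
  by rewrite !qmulA.
have im1 : qim (axis B1) = s *: y.
  have axis1E : axis B1 = (qre (axis B) * qnorm a) *: quat 1 0 0 0 + s *: y.
    rewrite axis1 {1}[axis B]qre_im qmulDr qmulDl; congr (_ + _).
      by rewrite qmulZr qmulr1 qmulZl qmul_conjr scalerA.
    rewrite -/x.
    have -> : qmul a x = (Num.sqrt (qnorm x) / Num.sqrt (qnorm y)) *: qmul y a.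
      move: aE; rewrite qmulZl qmulZr mulrC -scalerA => ->.
      by rewrite scalerA mulVf ?gt_eqF// scale1r.
    by rewrite qmulZl -qmulA qmul_conjr qmulZr qmulr1 scalerA mulrC mulrA.
  by rewrite axis1E /y qim_add.
exists a, (qmul (qconj (fr0 B')) (fr0 B1)); split => //.
  by rewrite qmul_eq0 qconj_eq0 !(negbTE (frame_row0_neq0 _)).
by rewrite (rmul_line _ _ im1) ?gt_eqF// line_act_pi.
Qed.

End Orbits.

(** * Parallelisms invariant under all left multiplications *)

Section Classification.
Variables (R : realType) (o : bool) (Pi : set (set (line R o))).
Hypothesis Pi_incident : forall C, Pi C -> forall v : 'rV[R]_4, v != 0 ->
  exists! L, C L /\ incident v L.
Hypothesis Pi_connected : forall C, Pi C -> connected C.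
Hypothesis Pi_partition : forall L, exists! C, Pi C /\ C L.
Hypothesis Pi_invariant : forall a C, a != 0 -> Pi C ->
  Pi (line_act (lmul_mx a) @` C).
Implicit Types (a b w : 'rV[R]_4) (B : frame R) (L : line R o)
  (C : set (line R o)).

Local Notation fr0 B := (row 0 (val B)).
Local Notation piL B := (\pi_(line R o) B).

Let incident_inj C w L L' : Pi C -> w != 0 -> C L -> C L' ->
  incident w L -> incident w L' -> L = L'.
Proof.
move=> PC w0 CL CL' wL wL'; have [L0 [_ U]] := Pi_incident PC w0.
by rewrite -(U L)// -(U L').
Qed.

Let class_inj C C' L : Pi C -> Pi C' -> C L -> C' L -> C = C'.
Proof.
move=> PC PC' CL CL'; have [C0 [_ U]] := Pi_partition L.
by rewrite -(U C)// -(U C').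
Qed.

Let class_nonempty C : Pi C -> exists B, C (piL B).
Proof.
move=> PC; have v0 : quat 1 0 0 0 != 0 :> 'rV[R]_4.
  by rewrite quat_neq0 oner_eq0.
have [L [[CL _] _]] := Pi_incident PC v0.
by elim/line_ind: L CL => B; exists B.
Qed.

Definition stabilizer C : set 'rV[R]_4 :=
  [set a | a != 0 /\ forall L, C L -> C (line_act (lmul_mx a) L)].

Let stabilizer_axis C B : Pi C -> C (piL B) ->
  contains_field (stabilizer C) (axis B).
Proof.
move=> PC CB s t st0; split=> // L CL.
have -> : C = line_act (lmul_mx (s *: quat 1 0 0 0 + t *: axis B)) @` C.
  apply: (class_inj PC (Pi_invariant st0 PC) CB).
  by exists (piL B) => //; exact: axis_stabilizes.
by exists L.
Qed.

Definition commuting_axes C := forall B B', C (piL B) -> C (piL B') ->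
  qmul (axis B) (axis B') = qmul (axis B') (axis B).

Lemma noncommuting_class C L : Pi C -> ~ commuting_axes C -> C L ->
  C = [set line_act g L | g in Lambda R].
Proof.
move=> PC nC; elim/line_ind: L => B CB.
have stab a : a != 0 -> forall L, C L -> C (line_act (lmul_mx a) L).
  have [B1 [B2 [CB1 CB2 B12]]] : exists B1 B2, [/\ C (piL B1), C (piL B2) &
      qmul (axis B1) (axis B2) != qmul (axis B2) (axis B1)].
    apply: contrapT => H; apply: nC => B1 B2 CB1 CB2.
    by apply/eqP/negPn/negP => B12; apply: H; exists B1, B2.
  move=> a0; suff [] : stabilizer C a by [].
  apply: (quaternions_generated _ (stabilizer_axis PC CB1)
    (stabilizer_axis PC CB2)) => // u v [u0 Cu] [v0 Cv]; split.
    by rewrite qmul_eq0 negb_or u0.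
  move=> L CL; rewrite -lmul_mxM -line_act_comp ?unitmx_lmul//.
  by apply: Cu; exact: Cv.
rewrite eqEsubset; split=> [L'|_ [_ [a a1 <-] <-]]; last first.
  by apply: stab => //; exact: qnorm1_neq0.
(* Up to a positive factor, a is u' u^-1. So the image of the line of [B] under a and the line of
   [B'] are members of C through the same point u', hence equal. *)
elim/line_ind: L' => B' CB'; pose a := qmul (fr0 B') (qconj (fr0 B)).
have a0 : a != 0 by rewrite qmul_eq0 qconj_eq0 !(negbTE (frame_row0_neq0 _)).
have aB : qmul a (fr0 B) = qnorm (fr0 B) *: fr0 B'.
  by rewrite /a -qmulA qmul_conjl qmulZr qmulr1.
suff -> : piL B' = line_act (lmul_mx a) (piL B) by exact: Lambda_orbit.
apply: (@incident_inj C (qmul a (fr0 B))) => //.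
- by rewrite qmul_eq0 negb_or a0 frame_row0_neq0.
- exact: stab.
- by rewrite aB; apply: incidentZ; exact: incident_row0.
- exact: incident_lmul.
Qed.

(** On frames of members of C the axes are parallel to that of [B], so f does not vanish, and its
    sign depends only on the oriented line. Hence C meets U in a subset that contains the line of
    [B] and is both open and closed in C; by connectedness it is all of C. *)
Lemma oriented_axes C B B' : Pi C -> commuting_axes C -> o ->
  C (piL B) -> C (piL B') -> 0 < im_dot (axis B') (axis B).
Proof.
move=> PC cC oT CB CB'.
pose f B' := im_dot (axis B') (axis B).
have f_neq0 B1 : C (piL B1) -> f B1 != 0.
  move=> CB1; have [s sE] := commuting_im (qim_axis_neq0 B) (cC _ _ CB CB1).
  rewrite /f (im_dotZ _ sE) mulf_neq0//; last first.
    by rewrite gt_eqF// im_dot_gt0// qim_axis_neq0.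
  by apply: contraNneq (qim_axis_neq0 B1) => s0; rewrite sE s0 scale0r.
have same_sign B1 B2 : piL B1 = piL B2 -> exists2 d, 0 < d & f B2 = d * f B1.
  move=> /line_piP/asboolP[M [uM oM] ME]; exists (\det M); first exact: oM.
  by rewrite /f (im_dotZ _ (qim_axis_mul ME)).
have repr_sign B1 : exists2 d, 0 < d & f (repr (piL B1)) = d * f B1.
  by apply: same_sign; rewrite reprK.
pose U := [set L : line R o | 0 < f (repr L)].
pose V := [set L : line R o | f (repr L) < 0].
have preU : \pi_(line R o) @^-1` U = f @^-1` [set y | 0 < y].
  apply/seteqP; split=> B1 /=; have [d d0 dE] := repr_sign B1;
    by rewrite /U /= dE pmulr_rgt0.
have preV : \pi_(line R o) @^-1` V = f @^-1` [set y | y < 0].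
  apply/seteqP; split=> B1 /=; have [d d0 dE] := repr_sign B1;
    by rewrite /V /= dE pmulr_rlt0.
have cf : continuous f by exact: im_dot_axis_continuous.
have oU : open U.
  change (open (\pi_(line R o) @^-1` U)); rewrite preU.
  by apply: open_comp; [move=> B1 _; exact: cf|exact: open_gt].
have oV : open V.
  change (open (\pi_(line R o) @^-1` V)); rewrite preV.
  by apply: open_comp; [move=> B1 _; exact: cf|exact: open_lt].
have CUE : C `&` U = C `&` ~` V.
  apply/seteqP; split=> L [CL H]; split=> //; move: H.
    by rewrite /U /V /= => H; apply/negP; rewrite -leNgt ltW.
  move: CL; elim/line_ind: L => B1 CB1; rewrite /U /V /= => /negP.
  have [d d0 ->] := repr_sign B1.
  by rewrite -leNgt le_eqVlt eq_sym mulf_eq0 gt_eqF//= (negbTE (f_neq0 _ CB1)).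
have : C `&` U = C.
  apply: (Pi_connected PC).
  - exists (piL B); split=> //; have [d d0 E] := repr_sign B.
    by rewrite /U /= E pmulr_rgt0// im_dot_gt0// qim_axis_neq0.
  - by exists U.
  - by exists (~` V) => //; rewrite closedC.
move=> /seteqP[_ /(_ _ CB')[_]]; rewrite /U /=.
by have [d d0 ->] := repr_sign B'; rewrite pmulr_rgt0.
Qed.

Lemma commuting_class C L : Pi C -> commuting_axes C -> C L ->
  C = [set line_act g L | g in @Upsilon R].
Proof.
move=> PC cC; elim/line_ind: L => B CB.
have rmulE B' : C (piL B') ->
    line_act (rmul_mx (qmul (qconj (fr0 B)) (fr0 B'))) (piL B) = piL B'.
  move=> CB'; have [s sE] := commuting_im (qim_axis_neq0 B) (cC _ _ CB CB').
  apply: (rmul_line _ _ sE).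
    by apply: contraNneq (qim_axis_neq0 B') => s0; rewrite sE s0 scale0r.
  move=> oT; have := oriented_axes PC cC oT CB CB'.
  by rewrite (im_dotZ _ sE) pmulr_lgt0// im_dot_gt0// qim_axis_neq0.
rewrite eqEsubset; split=> [L'|_ [_ [b b1 <-] <-]].
  elim/line_ind: L' => B' CB'; rewrite -(rmulE _ CB'); apply: Upsilon_orbit.
  by rewrite qmul_eq0 qconj_eq0 !(negbTE (frame_row0_neq0 _)).
(* Conversely, the member of C through the point u b arises from the line of [B] by right
   multiplication with conj(u) (u b) = |u|^2 b, that is, with b. *)
have b0 := qnorm1_neq0 b1.
have w0 : qmul (fr0 B) b != 0 by rewrite qmul_eq0 negb_or frame_row0_neq0.
have [L' [[CL' iL'] _]] := Pi_incident PC w0.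
have [B' BL' Bw] := incident_frame w0 iL'.
move: CL'; rewrite BL' => CB'; have := rmulE _ CB'.
rewrite Bw qmulA qmul_conjl qmulZl qmul1r rmul_mxZ line_act_scale.
- by move=> ->.
- by rewrite qnorm_eq0 frame_row0_neq0.
- exact: unitmx_rmul.
Qed.

Lemma parallelism_orbits :
  (forall C L, Pi C -> C L -> C = [set line_act g L | g in Lambda R]) \/
  (forall C L, Pi C -> C L -> C = [set line_act g L | g in @Upsilon R]).
Proof.
have [[C0 [PC0 cC0]]|H] := pselect (exists C, Pi C /\ commuting_axes C).
  right=> C L PC CL; apply: commuting_class => //.
  apply: contrapT => nC; apply: (nC).
  suff -> : C = C0 by [].
  have [B CB] := class_nonempty PC; have [B0 CB0] := class_nonempty PC0.
  have [a [b [a0 b0 E]]] := @Lambda_meets_Upsilon R o B B0.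
  apply: (class_inj PC PC0 (L := line_act (lmul_mx a) (piL B))).
    by rewrite (noncommuting_class PC nC CB); exact: Lambda_orbit.
  by rewrite E (commuting_class PC0 cC0 CB0); exact: Upsilon_orbit.
left=> C L PC CL; apply: noncommuting_class => // cC.
by apply: H; exists C.
Qed.

Lemma orbit_parallelism (G : set 'M[R]_4) :
  (forall C L, Pi C -> C L -> C = [set line_act g L | g in G]) ->
  Pi = [set [set line_act g L | g in G] | L in setT].
Proof.
move=> GC; apply/seteqP; split=> [C PC|_ [L _ <-]].
  have [B CB] := class_nonempty PC; exists (piL B) => //.
  by rewrite -(GC _ _ PC CB).
by have [C [[PC CL] _]] := Pi_partition L; rewrite -(GC _ _ PC CL).
Qed.

End Classification.

(** Quaternion conjugation is an antiautomorphism, so it exchanges left and right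
    multiplications. *)
Lemma conj_Upsilon_orbit (R : realType) (o : bool) (L : line R o) :
  line_act (conj_mx R) @` [set line_act g L | g in @Upsilon R] =
  [set line_act g (line_act (conj_mx R) L) | g in Lambda R].
Proof.
have conjE b : b != 0 -> line_act (conj_mx R) (line_act (rmul_mx b) L) =
    line_act (lmul_mx (qconj b)) (line_act (conj_mx R) L).
  move=> b0; rewrite !line_act_comp ?rmul_mx_conj ?unitmx_conj ?unitmx_rmul//.
  by rewrite unitmx_lmul// qconj_eq0.
apply/seteqP; split=> [_ [_ [_ [b b1 <-] <-] <-]|_ [_ [a a1 <-] <-]].
  rewrite conjE ?qnorm1_neq0//; apply: Lambda_orbit.
  by rewrite qconj_eq0 qnorm1_neq0.
have a0 := qnorm1_neq0 a1.
exists (line_act (rmul_mx (qconj a)) L).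
  by apply: Upsilon_orbit; rewrite qconj_eq0.
by rewrite conjE ?qconj_eq0// qconjK.
Qed.

(** * The action of SU(2) as left multiplications by unit quaternions *)

Section SpecialUnitary.
Variable R : realType.
Implicit Types (a u : 'rV[R]_4).

(* The row (Re z1, Re z2, Im z1, Im z2) goes to the conjugate of the quaternion
   z1 + z2 j, on which SU(2) acts by right multiplication. *)
Definition coord_quat u : 'rV[R]_4 :=
  quat (u 0 (inord 0)) (- u 0 (inord 2)) (- u 0 (inord 1)) (- u 0 (inord 3)).

Definition coord_mx : 'M[R]_4 := lin1_mx coord_quat.

Lemma mul_coord_mx u : u *m coord_mx = coord_quat u.
Proof.
apply: mul_lin1_mx => s v w.
have [a [b [c [d ->]]]] := quatP v; have [a1 [b1 [c1 [d1 ->]]]] := quatP w.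
by rewrite /coord_quat !(quat_simp, quatE); congr quat; ring.
Qed.

Lemma coord_mxK : coord_mx *m coord_mx = 1%:M.
Proof.
apply: mulmx_rV_inj => u; rewrite mulmxA !mul_coord_mx mulmx1.
have [a [b [c [d ->]]]] := quatP u.
by rewrite /coord_quat !quatE !opprK.
Qed.

Lemma unitmx_coord : coord_mx \in unitmx.
Proof. by have [] := mulmx1_unit coord_mxK. Qed.

Lemma mul_realify (x0 y0 x1 y1 x2 y2 x3 y3 a b c d : R) :
  quat a b c d *m realify (mx2 (Complex x0 y0) (Complex x1 y1)
                               (Complex x2 y2) (Complex x3 y3)) =
  quat (a * x0 + b * x2 - c * y0 - d * y2) (a * x1 + b * x3 - c * y1 - d * y3)
       (a * y0 + b * y2 + c * x0 + d * x2) (a * y1 + b * y3 + c * x1 + d * x3).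
Proof.
pose rv (x y : R) : 'rV[R]_2 := \row_j nth 0 [:: x; y] j.
have quat_row x y z t : quat x y z t = row_mx (rv x y) (rv z t) :> 'rV_(2 + 2).
  apply/rowP => j; rewrite -[j]splitK; case: (fintype.split j) => k /=.
    by rewrite row_mxEl !mxE; case: k => [[|[|//]]].
  by rewrite row_mxEr !mxE; case: k => [[|[|//]]].
rewrite /realify /= !quat_row (@mul_row_block R 1 2 2 2 2).
by apply: (f_equal2 (@row_mx R 1 2 2)); apply/rowP => -[[|[|//]] Hj];
  rewrite !mxE !big_ord_recl !big_ord0 !mxE /=; ring.
Qed.

Lemma lmul_mx_SU2 a : qnorm a = 1 ->
  exists2 k, irreducible_SO3 R k & coord_mx *m lmul_mx a = k *m coord_mx.
Proof.
have [a0 [a1 [a2 [a3 ->]]]] := quatP a; rewrite quat_norm => E.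
(* With conj(a) = p + q j for complex p and q, the rows of [A] are (p, q) and (- conj(q), conj(p)):
   this is right multiplication by conj(a) on z1 + z2 j. *)
pose A := mx2 (Complex a0 (- a1)) (Complex (- a2) (- a3))
              (Complex a2 (- a3)) (Complex a0 a1).
exists (realify A); last first.
  apply: mulmx_rV_inj => u; rewrite !mulmxA mul_coord_mx mul_lmul_mx.
  have [b0 [b1 [b2 [b3 ->]]]] := quatP u.
  rewrite mul_realify mul_coord_mx /coord_quat !quatE quat_mul.
  by congr quat; ring.
exists A => //; split; last first.
  rewrite /A det_mx2; apply/eqP; rewrite eq_complex /=.
  by apply/andP; split; apply/eqP; [rewrite -E; ring|ring].
apply/unitarymxP/matrixP => -[[|[|//]] Hi] [[|[|//]] Hj];
  rewrite !mxE !big_ord_recl big_ord0 !mxE /=; apply/eqP; rewrite eq_complex /=;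
  by apply/andP; split; apply/eqP; rewrite -?E; ring.
Qed.

End SpecialUnitary.

(** * Transport of parallelisms by collineations *)

Section Transfer.
Variables (R : realType) (o : bool).
Implicit Types (P : set (set (line R o))) (g h : 'M[R]_4) (L : line R o).

Lemma continuous_mulmxr m n p (T : topologicalType) (f : T -> 'M[R]_(m, n))
    (h : 'M[R]_(n, p)) :
  continuous f -> continuous (fun t => f t *m h).
Proof.
move=> cf t A [Q Qt QA].
apply: (@filterS _ _ (nbhs_filter t) _ _ (fun t' => QA (f t' *m h))).
apply: filter_forall => i; apply: filter_forall => j.
suff : continuous (fun t => (f t *m h) i j) by move=> /(_ t (Q i j)); apply.
rewrite [X in continuous X](_ : _ =
    (fun t => \sum_k f t i k * h k j)); last first.
  by apply/funext => ?; rewrite mxE.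
apply: continuous_big => [|k _ t']; first exact: add_continuous.
apply: continuousM; last exact: cst_continuous.
apply: (@continuous_comp _ _ _ f (fun M : 'M[R]_(m, n) => M i k) t').
  exact: cf.
exact: coord_continuous.
Qed.

(** By the quotient topology, continuity can be checked on frames, where the map is matrix
    multiplication. It is used to carry over connectedness. *)
Lemma line_act_continuous g : g \in unitmx -> continuous (@line_act R o g).
Proof.
move=> ug; apply/quotient_continuous.
rewrite (_ : _ \o _ =
    \pi_(line R o) \o (fun B => insubd B (val B *m g))); last first.
  by apply/funext => B; rewrite /= line_act_pi.
move=> B; apply: continuous_comp; last exact: pi_continuous.
move: B; apply: continuous_comp_initial.
rewrite (_ : _ \o _ = (fun B : frame R => val B *m g)); last first.
  by apply/funext => B; exact: val_frame_act.
by apply: continuous_mulmxr; exact: initial_continuous.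
Qed.

Lemma act_family_comp g h P : g \in unitmx -> h \in unitmx ->
  act_family h (act_family g P) = act_family (g *m h) P.
Proof.
move=> ug uh; rewrite /act_family image_comp; apply: eq_imagel => C _ /=.
by rewrite image_comp; apply: eq_imagel => L _ /=; rewrite line_act_comp.
Qed.

End Transfer.

Theorem mainTheorem2 (R : realType) (o : bool) (Pi : set (set (line R o)))
    (Pi_parallelism : parallelism Pi)
    (Aut_Pi : exists2 g : 'M[R]_4, g \in unitmx &
       [set invmx g *m h *m g | h in irreducible_SO3 R] `<=` Aut Pi) :
  equivalent Pi (clifford R o).
Proof.
have [Pi_spread Pi_partition _] := Pi_parallelism.
have [g ug gAut] := Aut_Pi.
(* The collineation [m] conjugates the given subgroup of [Aut Pi] to the left multiplications, so
   the classification is applied to the image [Q] of [Pi]. *)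
pose m := invmx g *m coord_mx R.
have um : m \in unitmx by rewrite unitmx_mul unitmx_inv ug unitmx_coord.
pose Q := act_family m Pi.
have Q_incident C : Q C -> forall v : 'rV[R]_4, v != 0 ->
    exists! L, C L /\ incident v L.
  move=> [C' PC' <-] v v0; have [_ _ C'_incident] := Pi_spread _ PC'.
  have v'0 : v *m invmx m != 0.
    by apply: contraNneq v0 => v'0; rewrite -[v](mulmxKV um) v'0 mul0mx.
  have [L [[CL vL] U]] := C'_incident _ v'0; exists (line_act m L); split.
    split; first by exists L.
    by rewrite -[v](mulmxKV um) incident_act.
  move=> _ [[L' CL' <-]]; rewrite -[v](mulmxKV um) incident_act// => vL'.
  by rewrite (U L').
have Q_connected C : Q C -> connected C.
  move=> [C' PC' <-]; have [_ C'_connected _] := Pi_spread _ PC'.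
  apply: connected_continuous_connected => //.
  by apply: continuous_subspaceT; exact: line_act_continuous.
have Q_partition L : exists! C, Q C /\ C L.
  have [C [[PC CL] U]] := Pi_partition (line_act (invmx m) L).
  exists (line_act m @` C); split.
    split; first by exists C.
    by exists (line_act (invmx m) L) => //; rewrite line_actKV.
  move=> _ [[C' PC' <-] [L' CL' LL']]; rewrite (U C')//; split=> //.
  by rewrite -LL' line_actK.
have Q_act a : a != 0 -> act_family (lmul_mx a) Q = Q.
  move=> a0; have [s s0 sa] := qnormalize a0.
  have [k SO3k kE] := lmul_mx_SU2 sa.
  have [uk Pik] := gAut _ (ex_intro2 _ _ k SO3k erefl).
  have -> : act_family (lmul_mx a) Q = act_family (lmul_mx (s *: a)) Q.
    by rewrite lmul_mxZ /act_family line_act_scale ?unitmx_lmul.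
  have usa : lmul_mx (s *: a) \in unitmx by rewrite unitmx_lmul ?qnorm1_neq0.
  (* Since m followed by the left multiplication equals g^-1 k g followed by m, and g^-1 k g fixes
     [Pi], the image [Q] is fixed. *)
  rewrite /Q act_family_comp// /m -mulmxA kE -[in RHS]Pik act_family_comp//.
  by congr act_family; rewrite !mulmxA mulmxK.
have Q_invariant a C : a != 0 -> Q C -> Q (line_act (lmul_mx a) @` C).
  by move=> a0 QC; rewrite -(Q_act _ a0); exists C.
have [orbits|orbits] :=
  parallelism_orbits Q_incident Q_connected Q_partition Q_invariant.
  exists m => //; exact: (orbit_parallelism Q_incident Q_partition orbits).
(* In this case [Q] is the right Clifford parallelism, and conjugation takes it to the left one. *)
exists (m *m conj_mx R); first by rewrite unitmx_mul um unitmx_conj.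
rewrite -act_family_comp ?unitmx_conj// -/Q.
rewrite (orbit_parallelism Q_incident Q_partition orbits).
apply/seteqP; split=> [_ [_ [L _ <-] <-]|_ [L _ <-]].
  by exists (line_act (conj_mx R) L) => //; rewrite conj_Upsilon_orbit.
exists [set line_act h (line_act (conj_mx R) L) | h in @Upsilon R].
  by exists (line_act (conj_mx R) L).
rewrite conj_Upsilon_orbit line_act_comp ?unitmx_conj//.
by rewrite conj_mxK line_act1.
Qed.
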